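(* For every $n\geqslant 2$, $$D(F_n\star K_1)=\Big\lceil \sqrt{\tfrac{1+\sqrt{8n+1}}{2}}\,\Big\rceil.$$
   Context: All graphs are finite and simple. The friendship graph $F_n$ ($n\geqslant 2$) is obtained by joining $n$ copies of the cycle $C_3$ at a common vertex. For a graph $G$, $G\star K_1$ is the graph obtained from $G$ by adding, for each vertex $v$ of $G$, a new vertex $K_1^{v}$ adjacent exactly to the neighbours of $v$ in $G$ (the neighbourhood corona of $G$ with $K_1$). The distinguishing number $D(G)$ is the least $r$ such that there is a labeling $V(G)\to\{1,\dots,r\}$ preserved by no non-identity automorphism of $G$. *)

(* Defs.v *)
From mathcomp Require Import all_boot all_fingroup.

Set Implicit Arguments.
Unset Strict Implicit.
Unset Printing Implicit Defensive.

Record sgraph := SGraph {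
  vertex :> finType;
  adj : rel vertex;
  adj_sym : symmetric adj;
  adj_irrefl : irreflexive adj }.

Arguments adj {s} _ _.

(* In friendship n, None is the common vertex, and Some (i, false) and
   Some (i, true) are the other two vertices of the i-th triangle: the i-th
   triangle is the set of the vertices x with in_triangle i x. *)
Definition friendship_vertex (n : nat) : finType := option ('I_n * bool).

Definition in_triangle (n : nat) (i : 'I_n) (x : friendship_vertex n) : bool :=
  if x is Some jb then jb.1 == i else true.

Definition friendship_adj (n : nat) : rel (friendship_vertex n) :=
  fun x y => (x != y) && [exists i : 'I_n, in_triangle i x && in_triangle i y].

Lemma friendship_adj_sym (n : nat) : symmetric (@friendship_adj n).
Proof.
move=> x y; rewrite /friendship_adj eq_sym; congr (_ && _).
by apply: eq_existsb => i; rewrite andbC.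
Qed.

Lemma friendship_adj_irrefl (n : nat) : irreflexive (@friendship_adj n).
Proof. by move=> x; rewrite /friendship_adj eqxx. Qed.

Definition friendship (n : nat) : sgraph :=
  SGraph (@friendship_adj_sym n) (@friendship_adj_irrefl n).

(* In ncorona_K1 G, inl v is the vertex v of G and inr v the new vertex K_1^v. *)
Definition ncorona_K1_adj (G : sgraph) : rel (G + G)%type :=
  fun x y =>
    match x, y with
    | inl u, inl v => adj u v
    | inl u, inr v => adj v u
    | inr u, inl v => adj u v
    | inr _, inr _ => false
    end.

Lemma ncorona_K1_adj_sym (G : sgraph) : symmetric (@ncorona_K1_adj G).
Proof. by move=> [u|u] [v|v] //=; rewrite adj_sym. Qed.

Lemma ncorona_K1_adj_irrefl (G : sgraph) : irreflexive (@ncorona_K1_adj G).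
Proof. by move=> [u|u] //=; rewrite adj_irrefl. Qed.

Definition ncorona_K1 (G : sgraph) : sgraph :=
  SGraph (@ncorona_K1_adj_sym G) (@ncorona_K1_adj_irrefl G).

Definition automorphism (G : sgraph) (p : {perm G}) : bool :=
  [forall x, forall y, adj (p x) (p y) == adj x y].

Definition preserves (G : sgraph) (L : finType) (p : {perm G})
    (f : {ffun G -> L}) : bool :=
  [forall x, f (p x) == f x].

Definition distinguishing (G : sgraph) (L : finType) (f : {ffun G -> L}) : bool :=
  [forall p : {perm G}, automorphism p && preserves p f ==> (p == 1%g)].

Definition distinguishable (G : sgraph) (r : nat) : bool :=
  [exists f : {ffun G -> 'I_r}, distinguishing f].

Lemma ex_distinguishable (G : sgraph) : exists r, distinguishable G r.
Proof.
exists #|G|; apply/existsP; exists [ffun x => enum_rank x].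
apply/forallP => p; apply/implyP => /andP[_ /forallP pf].
apply/eqP/permP => x; rewrite perm1.
by have := pf x; rewrite !ffunE => /eqP/enum_rank_inj.
Qed.

Definition distinguishing_number (G : sgraph) : nat :=
  ex_minn (ex_distinguishable G).

(* Main.v *)
Require Import Defs.
From mathcomp Require Import all_boot all_order all_algebra all_fingroup.
From mathcomp Require Import reals.
From mathcomp Require Import lra.
Import Order.TTheory GRing.Theory Num.Theory.

Set Implicit Arguments.
Unset Strict Implicit.
Unset Printing Implicit Defensive.

(** Every automorphism of [F_n * K_1] fixes the centre [c] (the only vertex with
    a single non-neighbour), hence its copy [c'] (that non-neighbour), hence it
    permutes the rim [N(c')], commuting with the swap of the two rim vertices
    of each triangle, and it moves the copies of the rim vertices along with
    them. Writing [u x] for the pair of labels of a rim vertex [x] and of its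
    copy, a labeling is thus distinguishing iff each triangle receives two
    different values of [u] and different triangles receive different
    2-subsets of the [r^2] possible values: this is possible iff
    [n <= 'C(r^2, 2)], and solving for [r] gives the formula. *)

Definition mate {n : nat} (x : 'I_n * bool) : 'I_n * bool := (x.1, ~~ x.2).

Lemma mateK {n : nat} : involutive (@mate n).
Proof. by move=> [i b]; rewrite /mate /= negbK. Qed.

Lemma mate_neq {n : nat} (x : 'I_n * bool) : (mate x == x) = false.
Proof. by case: x => i [] ; rewrite /mate xpair_eqE eqxx. Qed.

Lemma eq_mate {n : nat} (x y : 'I_n * bool) : (mate x == mate y) = (x == y).
Proof. exact: (inj_eq (can_inj mateK)). Qed.

Lemma mate_eqC {n : nat} (x y : 'I_n * bool) : (mate x == y) = (x == mate y).
Proof. by rewrite -eq_mate mateK. Qed.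

Lemma friendship_adjSS {n : nat} (x y : 'I_n * bool) :
  @adj (friendship n) (Some x) (Some y) = (y == mate x).
Proof.
rewrite /= /friendship_adj; case: x y => i b [j c] /=.
apply/andP/eqP => [[xy /existsP[k /andP[/eqP ik /eqP jk]]]|[-> ->]].
  by move: xy; rewrite /mate /= ik jk; case: b c => [] []; rewrite ?eqxx.
split; last by apply/existsP; exists i; rewrite eqxx.
by apply/eqP => -[]; case: b.
Qed.

Lemma friendship_adjNS {n : nat} (x : 'I_n * bool) :
  @adj (friendship n) None (Some x).
Proof.
by rewrite /= /friendship_adj /=; apply/existsP; exists x.1; rewrite eqxx.
Qed.

Lemma friendship_adjSN {n : nat} (x : 'I_n * bool) :
  @adj (friendship n) (Some x) None.
Proof. by rewrite adj_sym friendship_adjNS. Qed.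

Lemma friendship_adjNN {n : nat} : @adj (friendship n) None None = false.
Proof. exact: adj_irrefl. Qed.

Definition friendship_adjE :=
  (@friendship_adjSS, @friendship_adjNS, @friendship_adjSN, @friendship_adjNN).

Lemma ncorona_adjE (G : sgraph) (x y : G + G) :
  @adj (ncorona_K1 G) x y =
    match x, y with
    | inl u, inl v => adj u v
    | inl u, inr v => adj v u
    | inr u, inl v => adj u v
    | inr _, inr _ => false
    end.
Proof. by []. Qed.

Lemma automorphismP (G : sgraph) (p : {perm G}) :
  reflect (forall x y, adj (p x) (p y) = adj x y) (automorphism p).
Proof.
apply: (iffP forallP) => [H x y|H x]; first exact/eqP/(forallP (H x)).
by apply/forallP => y; rewrite H.
Qed.

Section FriendshipCorona.
Variables (n : nat) (hn : 2 <= n).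

Local Notation Gn := (ncorona_K1 (friendship n)).
Local Notation rim := ('I_n * bool)%type.
Local Arguments adj : simpl never.

Lemma automorphism_centre (p : {perm Gn}) :
  automorphism p -> p (inl None) = inl None :> Gn.
Proof.
move=> /automorphismP pA.
have cN (z : Gn) : ~~ adj (inl None : Gn) z -> z \in [:: inl None; inr None].
  by case: z => -[x|]; rewrite ncorona_adjE ?friendship_adjE.
have small (s : seq Gn) : uniq s -> all (fun z => ~~ adj (p (inl None)) z) s ->
    size s <= 2.
  move=> us /allP sN; rewrite -(size_map (p^-1)%g).
  apply: (@uniq_leq_size _ _ [:: inl None; inr None]).
    by rewrite map_inj_uniq //; apply: perm_inj.
  by move=> _ /mapP[z zs ->]; apply: cN; rewrite -pA permKV; apply: sN.
pose i0 : 'I_n := Ordinal (ltnW hn).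
have other (i : 'I_n) : exists j, j != i.
  pose i1 : 'I_n := Ordinal hn.
  by case: (eqVneq i i0) => [->|ni]; [exists i1|exists i0; rewrite eq_sym].
case E: (p (inl None)) small => [[[i b]|]|v] small //; last first.
  have := small [:: inr None; inr (Some (i0, true)); inr (Some (i0, false))].
  by rewrite /= => /(_ isT isT).
have [j ji] := other i.
have := small [:: inl (Some (i, b)); inl (Some (j, true)); inl (Some (j, false))].
have Ht c : (Some (i, b) == Some (j, c)) = false.
  by apply/eqP => -[ij _]; move: ji; rewrite ij eqxx.
rewrite /= !inE.
rewrite !(inj_eq (@inl_inj _ _)) !Ht /= !ncorona_adjE !friendship_adjE.
rewrite [_ == mate (i, b)]eq_sym mate_neq /mate !(inj_eq Some_inj) !xpair_eqE (negPf ji) andbF /=.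
by move=> /(_ isT isT).
Qed.

Lemma automorphism_centre_copy (p : {perm Gn}) :
  automorphism p -> p (inr None) = inr None :> Gn.
Proof.
move=> pA; have pc := automorphism_centre pA; move/automorphismP: pA => pA.
have := pA (inl None) (inr None); have := @perm_inj _ p (inr None) (inl None).
rewrite pc; case: (p (inr None)) => -[x|] //; rewrite ?ncorona_adjE ?friendship_adjE //.
by move=> /(_ erefl).
Qed.

Lemma automorphism_rim (p : {perm Gn}) : automorphism p ->
  exists s : rim -> rim, [/\ forall x, s (mate x) = mate (s x),
    forall x, p (inl (Some x)) = inl (Some (s x)) :> Gn &
    forall x, p (inr (Some x)) = inr (Some (s x)) :> Gn].
Proof.
move=> pA; have pc := automorphism_centre pA.
have pc' := automorphism_centre_copy pA; move/automorphismP: pA => pA.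
pose s (x : rim) : rim := if p (inl (Some x)) is inl (Some y) then y else x.
have sl x : p (inl (Some x)) = inl (Some (s x)) :> Gn.
  have := pA (inr None) (inl (Some x)); rewrite pc' /s.
  by case: (p _) => -[y|] //; rewrite !ncorona_adjE ?friendship_adjE.
have sm x : s (mate x) = mate (s x).
  have := pA (inl (Some x)) (inl (Some (mate x))).
  by rewrite !sl !ncorona_adjE !friendship_adjE eqxx => /eqP.
exists s; split=> // x.
have := pA (inr (Some x)) (inr None); rewrite pc'.
have := pA (inr (Some x)) (inl (Some (mate x))).
have := @perm_inj _ p (inr (Some x)) (inr None).
have := @perm_inj _ p (inr (Some x)) (inl None).
rewrite pc pc' sl sm; case: (p _) => -[y|] pinj pinj';
  rewrite !ncorona_adjE ?friendship_adjE ?eqxx //.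
- by have := pinj erefl.
- by rewrite eq_mate => /eqP ->.
- by have := pinj' erefl.
Qed.

Definition rim_lift (s : rim -> rim) (v : Gn) : Gn :=
  match v with
  | inl (Some x) => inl (Some (s x))
  | inr (Some x) => inr (Some (s x))
  | inl None => inl None
  | inr None => inr None
  end.

Lemma rim_liftK (s : rim -> rim) : involutive s -> involutive (rim_lift s).
Proof. by move=> sK [[x|]|[x|]] //=; rewrite sK. Qed.

Lemma rim_lift_automorphism (s : rim -> rim) (sK : involutive s) :
  (forall x, s (mate x) = mate (s x)) ->
  automorphism (perm (can_inj (rim_liftK sK)) : {perm Gn}).
Proof.
move=> sm; apply/automorphismP => x y; rewrite !permE.
case: x => -[x|]; case: y => -[y|] //;
  by rewrite !ncorona_adjE /= ?friendship_adjE -?sm ?(inj_eq (can_inj sK)).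
Qed.

(* Not [tperm x y * tperm (mate x) (mate y)], which would be the identity
   when [y = mate x]. *)
Definition mate_tperm (x y z : rim) : rim :=
  if z == x then y else if z == y then x else
  if z == mate x then mate y else if z == mate y then mate x else z.

Lemma mate_tperm_mate (x y z : rim) :
  mate_tperm x y (mate z) = mate (mate_tperm x y z).
Proof.
rewrite /mate_tperm !mate_eqC !mateK.
case: (eqVneq z x) => [->|zx].
  rewrite [x == mate x]eq_sym mate_neq.
  by case: (eqVneq x (mate y)) => [->|].
case: (eqVneq z y) => [->|zy].
  rewrite [y == mate y]eq_sym mate_neq.
  by case: (eqVneq y (mate x)) => [->|].
by case: ifP; rewrite ?mateK //; case: ifP; rewrite ?mateK.
Qed.

Lemma mate_tpermK (x y : rim) : involutive (mate_tperm x y).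
Proof.
move=> z; rewrite {2}/mate_tperm.
case: (eqVneq z x) => [->|zx].
  by rewrite /mate_tperm eqxx; case: eqP.
case: (eqVneq z y) => [->|zy].
  by rewrite /mate_tperm eqxx.
case: (eqVneq z (mate x)) => [->|zx'].
  by rewrite mate_tperm_mate /mate_tperm eqxx; case: eqP => [->|].
case: (eqVneq z (mate y)) => [->|zy'].
  by rewrite mate_tperm_mate /mate_tperm eqxx.
by rewrite /mate_tperm (negPf zx) (negPf zy) (negPf zx') (negPf zy').
Qed.

Section Labels.
Variable L : finType.

Definition rim_label (f : {ffun Gn -> L}) (x : rim) : L * L :=
  (f (inl (Some x)), f (inr (Some x))).

Definition edge_label (f : {ffun Gn -> L}) (x : rim) : (L * L) * (L * L) :=
  (rim_label f x, rim_label f (mate x)).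

Lemma distinguishingP (f : {ffun Gn -> L}) :
  reflect (injective (edge_label f)) (distinguishing f).
Proof.
apply: (iffP forallP) => [fD x y [fl fr gl gr]|finj p].
  have := fD (perm (can_inj (rim_liftK (mate_tpermK x y)))).
  rewrite rim_lift_automorphism /=; last exact: mate_tperm_mate.
  move=> /implyP H; have /H /eqP : preserves
      (perm (can_inj (rim_liftK (mate_tpermK x y)))) f.
    apply/forallP => -[[z|]|[z|]]; rewrite permE //= /mate_tperm.
      by do 4!(case: (z =P _) => [->|_]; rewrite ?fl ?gl ?fr ?gr //).
    by do 4!(case: (z =P _) => [->|_]; rewrite ?fl ?gl ?fr ?gr //).
  move=> /permP/(_ (inl (Some x))); rewrite permE perm1 /=.
  by rewrite /mate_tperm eqxx => -[->].
apply/implyP => /andP[pA /forallP pf].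
have [s [sm sl sr]] := automorphism_rim pA.
have us x : rim_label f (s x) = rim_label f x.
  by rewrite /rim_label -sl -sr (eqP (pf _)) (eqP (pf _)).
have s1 x : s x = x by apply: finj; rewrite /edge_label -sm !us.
apply/eqP/permP => -[[x|]|[x|]]; rewrite perm1.
- by rewrite sl s1.
- exact: automorphism_centre.
- by rewrite sr s1.
- exact: automorphism_centre_copy.
Qed.

Lemma distinguishing_card (f : {ffun Gn -> L}) :
  distinguishing f -> n <= 'C(#|L| ^ 2, 2).
Proof.
move=> /distinguishingP finj; rewrite -{1}(card_ord n).
have -> : #|L| ^ 2 = #|{: L * L}| by rewrite card_prod.
rewrite -card_draws.
pose g i := [set rim_label f (i, false); rim_label f (i, true)].
have ne i : rim_label f (i, false) != rim_label f (i, true).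
  apply/eqP => e.
  suff [] : (i, false) = (i, true) by [].
  by apply: finj; rewrite /edge_label /mate /= e.
have ginj : injective g.
  move=> i j gij.
  have := set21 (rim_label f (i, false)) (rim_label f (i, true)).
  have := set22 (rim_label f (i, false)) (rim_label f (i, true)).
  rewrite -/(g i) gij !inE => /orP[]/eqP e1 /orP[]/eqP e2;
    try by have := ne i; rewrite e1 e2 eqxx.
  - have [] // : (i, false) = (j, true).
    by apply: finj; rewrite /edge_label /mate /= e1 e2.
  - have [] // : (i, false) = (j, false).
    by apply: finj; rewrite /edge_label /mate /= e1 e2.
rewrite -(card_imset _ ginj); apply: subset_leq_card.
by apply/subsetP => _ /imsetP[i _ ->]; rewrite inE cards2 ne.
Qed.

Lemma card_distinguishing :
  n <= 'C(#|L| ^ 2, 2) -> exists f : {ffun Gn -> L}, distinguishing f.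
Proof.
have -> : #|L| ^ 2 = #|{: L * L}| by rewrite card_prod.
rewrite -card_draws => nC.
pose g (i : 'I_n) := enum_val (widen_ord nC i).
have ginj : injective g.
  by move=> i j /enum_val_inj /(congr1 val) /= /val_inj.
have /fin_all_exists2[u une uE] : forall i, exists2 q : (L * L) * (L * L),
    q.1 != q.2 & g i = [set q.1; q.2].
  move=> i; have := enum_valP (widen_ord nC i).
  by rewrite inE => /cards2P[x [y [xy e]]]; exists (x, y).
have l0 : L.
  by case: (u (Ordinal hn)) => -[].
pose v (x : rim) := if x.2 then (u x.1).2 else (u x.1).1.
pose f : {ffun Gn -> L} := [ffun z => match z with
  | inl (Some x) => (v x).1 | inr (Some x) => (v x).2 | _ => l0 end].
exists f; apply/distinguishingP.
have fv x : rim_label f x = v x by rewrite /rim_label !ffunE -surjective_pairing.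
have gv x : g x.1 = [set v x; v (mate x)].
  by rewrite uE /v; case: x => i [] //=; rewrite setUC.
move=> x y; rewrite /edge_label !fv => -[e1 e2].
have /ginj : g x.1 = g y.1 by rewrite !gv e1 e2.
move: e1; rewrite /v; case: x y {e2} => i [] [j []] //= + ij; rewrite ij // => e;
  by have := une j; rewrite e eqxx.
Qed.

End Labels.

Lemma distinguishable_friendship_corona (r : nat) :
  distinguishable Gn r = (n <= 'C(r ^ 2, 2)).
Proof.
apply/existsP/idP => [[f /distinguishing_card]|nC]; first by rewrite card_ord.
by apply: card_distinguishing; rewrite card_ord.
Qed.

End FriendshipCorona.

Local Open Scope ring_scope.

Lemma sqrt_le_bin2 (R : realType) (n r : nat) : (0 < n)%N ->
  (Num.sqrt ((1 + Num.sqrt (8 * n%:R + 1)) / 2) <= r%:R :> R)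
    = (n <= 'C(r ^ 2, 2))%N.
Proof.
move=> n0.
have s0 := sqrtr_ge0 (8 * n%:R + 1 : R).
rewrite -[r%:R]ger0_norm ?ler0n // -sqrtr_sqr ler_sqrt ?exprn_ge0 ?ler0n //.
rewrite -natrX; move: (r ^ 2)%N => q.
have n0' : (1 : R) <= n%:R by rewrite ler1n.
have [q0|q0] := posnP q.
  by rewrite q0 bin0n (leqNgt n) n0 /=; apply/negbTE; rewrite -ltNge; lra.
have q1 : (1 : R) <= q%:R by rewrite ler1n.
have -> : ((1 + Num.sqrt (8 * n%:R + 1)) / 2 <= q%:R :> R)
    = (Num.sqrt (8 * n%:R + 1) <= 2 * q%:R - 1 :> R) by apply/idP/idP; lra.
have -> : 2 * q%:R - 1 = Num.sqrt ((2 * q%:R - 1) ^+ 2) :> R.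
  by rewrite sqrtr_sqr ger0_norm //; lra.
rewrite ler_sqrt ?sqr_ge0 //.
have eC : (2 * 'C(q, 2) = q * q.-1)%N by rewrite -mul_bin_diag bin1.
have {}eC : 2 * 'C(q, 2)%:R = q%:R * (q%:R - 1) :> R.
  by rewrite -natrM eC natrM -subn1 natrB.
have -> : (2 * q%:R - 1) ^+ 2 = 8 * 'C(q, 2)%:R + 1 :> R by lra.
by rewrite lerD2r ler_pM2l ?ltr0n // ler_nat.
Qed.

Theorem theorem3p3 (R : realType) (n : nat) (hn : (2 <= n)%N) :
  (distinguishing_number (ncorona_K1 (friendship n)))%:Z =
  Num.ceil (Num.sqrt ((1 + Num.sqrt (8 * n%:R + 1)) / 2) : R).
Proof.
rewrite /distinguishing_number; case: ex_minnP => d.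
rewrite distinguishable_friendship_corona // => dC dmin.
set x := Num.sqrt _.
have ceilE (r : nat) : (Num.ceil x <= r%:Z) = (n <= 'C(r ^ 2, 2))%N.
  by rewrite ceil_le_int -pmulrn sqrt_le_bin2 //; apply: ltnW.
have : 0 <= Num.ceil x by rewrite -(ceil0 R) le_ceil // sqrtr_ge0.
case E: (Num.ceil x) => [k|//] _; apply/eqP; rewrite eq_le.
apply/andP; split; last by rewrite -E ceilE.
by rewrite lez_nat; apply: dmin; rewrite distinguishable_friendship_corona // -ceilE E.
Qed.
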